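(* Let $k$ be an algebraically closed field with $\operatorname{char}(k)\nmid(d+1)!$, $V$ an $n$-dimensional $k$-vector space, $S=\operatorname{Sym}V$, and consider the gradient morphism $\nabla\colon\mathbb{P}(S_{d+1})^{c}\to\operatorname{Grass}(n,S_d)$, $\bar f\mapsto\langle\nabla f\rangle$. (A) Suppose $f\in S_{d+1}$ is concise. Then the following are equivalent: (1) $f$ is either a direct sum or an LDS form; (2) $\nabla$ is not injective at $\bar f$, i.e. there exists $\bar g\neq\bar f$ in $\mathbb{P}(S_{d+1})^c$ with $\nabla f=\nabla g$; (3) $\nabla$ has positive fiber dimension at $\bar f$, i.e. $\nabla^{-1}(\nabla\bar f)$ has dimension $\geq1$ at $\bar f$. (B) If $f\in S_{d+1}$ is GIT semistable with respect to the standard $\mathrm{SL}(n)$-action, then the following are equivalent: (1) $f$ is a direct sum; (2) $\nabla$ is not injective at $\bar f$; (3) $\nabla$ has positive fiber dimension at $\bar f$.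
   Context: $\langle\nabla f\rangle$ is the span of the first partials of $f$ in $S_d$. $\mathbb{P}(S_{d+1})^c=\{\bar f\in\mathbb{P}S_{d+1}\mid\dim_k\langle\nabla f\rangle=n\}$; under the characteristic assumption this is the locus of concise forms, i.e. forms not expressible as polynomials in fewer than $n$ linear forms. A form $f$ is a direct sum if $V=U\oplus W$ and $f=f_1+f_2$ with nonzero $f_1\in\operatorname{Sym}^{d+1}U$, $f_2\in\operatorname{Sym}^{d+1}W$. A form $f$ is LDS if, after a linear change of variables, $f=\sum_{i=1}^{\ell}x_i\,\frac{\partial H(x_{\ell+1},\dots,x_{2\ell})}{\partial x_{\ell+i}}+G(x_{\ell+1},\dots,x_n)$ with $H,G$ forms of degree $d+1$ in $\ell$ and $n-\ell$ variables. *)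

(* Defs.v *)
From HB Require Import structures.
From mathcomp Require Import all_boot all_order all_algebra.
From mathcomp Require Import mpoly.

Set Implicit Arguments.
Unset Strict Implicit.
Unset Printing Implicit Defensive.

Import Order.TTheory GRing.Theory.
Local Open Scope ring_scope.

Section Defs.
Variables (k : fieldType) (n d : nat).

Definition grad_span (f : {mpoly k[n]}) : {mpoly k[n]} -> Prop :=
  fun p => exists c : 'I_n -> k, p = \sum_(i < n) c i *: mderiv i f.

Definition same_grad (f g : {mpoly k[n]}) : Prop :=
  forall p, grad_span f p <-> grad_span g p.

(* dim_k <nabla f> = n : the n partials span an n-dimensional space,
   i.e. they are linearly independent *)
Definition concise (f : {mpoly k[n]}) : Prop :=
  forall c : 'I_n -> k, \sum_(i < n) c i *: mderiv i f = 0 -> forall i, c i = 0.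

(* the locus P(S_{d+1})^c, described on representatives (nonzero forms) *)
Definition in_domain (g : {mpoly k[n]}) : Prop :=
  [/\ g \is (d.+1).-homog, g != 0 & concise g].

Definition lin_subst (A : 'M[k]_n) : n.-tuple {mpoly k[n]} :=
  [tuple \sum_(j < n) A i j *: 'X_j | i < n].

Definition vars_in (lo hi : nat) (p : {mpoly k[n]}) : Prop :=
  forall m, m \in msupp p -> forall i : 'I_n, (m i != 0)%N -> (lo <= i < hi)%N.

(* V = U (+) W, f = f1 + f2 with nonzero f1 in Sym^{d+1} U, f2 in Sym^{d+1} W;
   in a basis adapted to U (+) W: after an invertible linear change of
   variables, f = f1(x_0..x_{m-1}) + f2(x_m..x_{n-1}). *)
Definition direct_sum (f : {mpoly k[n]}) : Prop :=
  exists (A : 'M[k]_n) (m : nat) (f1 f2 : {mpoly k[n]}),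
    [/\ A \in unitmx,
        [/\ f1 \is (d.+1).-homog, f1 != 0 & vars_in 0 m f1],
        [/\ f2 \is (d.+1).-homog, f2 != 0 & vars_in m n f2] &
        f \mPo lin_subst A = f1 + f2].

(* LDS: after a linear change of variables,
   f = sum_{i<l} x_i * dH/dx_{l+i} (x_l..x_{2l-1}) + G(x_l..x_{n-1}),
   H, G forms of degree d+1 in l resp. n-l variables, 1 <= l, 2l <= n. *)
Definition LDS (f : {mpoly k[n]}) : Prop :=
  exists (A : 'M[k]_n) (l : nat) (H G : {mpoly k[n]}),
    [/\ A \in unitmx, (1 <= l <= n - l)%N,
        (H \is (d.+1).-homog /\ vars_in l (l + l) H),
        (G \is (d.+1).-homog /\ vars_in l n G) &
        f \mPo lin_subst A =
          \sum_(i < n) \sum_(j < n | (i < l)%N && (j == l + i :> nat))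
             'X_i * mderiv j H + G].

(* linear coordinates on S_{d+1} (we use all coefficients of monomials of
   degree <= d+1; those of degree < d+1 vanish identically on S_{d+1}) *)
Definition mon := 'X_{1..n < d.+2}.
Definition ncoord := #|{: mon}|.
Definition coords (g : {mpoly k[n]}) : 'I_ncoord -> k :=
  fun j => g@_(bmnm (enum_val j)).

(* Zariski closed subsets of P(S_{d+1}) (as cones of representatives):
   common zero loci of families of homogeneous polynomial functions *)
Definition zclosed (C : {mpoly k[n]} -> Prop) : Prop :=
  exists Ps : {mpoly k[ncoord]} -> Prop,
    (forall P, Ps P -> exists e, P \is e.-homog) /\
    (forall g, C g <-> forall P, Ps P -> P.@[coords g] = 0).

Definition closed_in (Y Z : {mpoly k[n]} -> Prop) : Prop :=
  exists C, zclosed C /\ forall g, Z g <-> (Y g /\ C g).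

Definition open_in (Y U : {mpoly k[n]} -> Prop) : Prop :=
  exists C, zclosed C /\ forall g, U g <-> (Y g /\ ~ C g).

Definition irred_space (Z : {mpoly k[n]} -> Prop) : Prop :=
  (exists g, Z g) /\
  forall Z1 Z2, closed_in Z Z1 -> closed_in Z Z2 ->
    (forall g, Z g <-> (Z1 g \/ Z2 g)) ->
    (forall g, Z g -> Z1 g) \/ (forall g, Z g -> Z2 g).

Definition dim_ge1 (U : {mpoly k[n]} -> Prop) : Prop :=
  exists Z0 Z1, [/\ closed_in U Z0 /\ irred_space Z0,
                    closed_in U Z1 /\ irred_space Z1,
                    (forall g, Z0 g -> Z1 g) &
                    exists g, Z1 g /\ ~ Z0 g].

Definition local_dim_ge1 (X : {mpoly k[n]} -> Prop) (x : {mpoly k[n]}) : Prop :=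
  forall U, open_in X U -> U x -> dim_ge1 U.

Definition grad_fiber (f : {mpoly k[n]}) : {mpoly k[n]} -> Prop :=
  fun g => in_domain g /\ same_grad g f.

Definition grad_not_injective (f : {mpoly k[n]}) : Prop :=
  exists g, [/\ in_domain g, (forall c : k, g != c *: f) & same_grad f g].

Definition pos_fiber_dim (f : {mpoly k[n]}) : Prop :=
  local_dim_ge1 (grad_fiber f) f.

Definition semistable (f : {mpoly k[n]}) : Prop :=
  exists (P : {mpoly k[ncoord]}) (e : nat),
    [/\ (0 < e)%N, P \is e.-homog,
        (forall A : 'M[k]_n, \det A = 1 -> forall g : {mpoly k[n]},
            g \is (d.+1).-homog ->
            P.@[coords (g \mPo lin_subst A)] = P.@[coords g]) &
        P.@[coords f] != 0].

End Defs.

(* Main.v *)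
Require Import Defs.
From Stdlib Require Import Classical.
From HB Require Import structures.
From mathcomp Require Import all_boot all_order all_algebra.
From mathcomp Require Import zify ring mpoly.

(** Two forms [f], [g] have comparable gradient spans exactly when
    [grad g = M (grad f)] for a constant matrix [M], and then [M (Hess f)] is
    symmetric. Hence [p(M) (Hess f)] is symmetric for every polynomial [p], and by
    Euler's formula [p(M) (grad f)] is again the gradient of a form. If [M] is not
    scalar, [k[M]] contains either an idempotent other than [0] and [1], or a
    nonzero element of square zero; in coordinates where this element is in normal
    form, [f] is visibly a direct sum, respectively an LDS form. Conversely both
    shapes supply a non-proportional [g].

    The fiber of the gradient map through [f] is the open subset [det M <> 0] of a
    linear space of forms, so that it is positive dimensional as soon as it
    contains a point other than [f].

    A semistable form is concise, and an LDS form of degree at least three is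
    driven to [0] by a one-parameter subgroup of [SL(n)]; quadratic and linear
    forms are treated separately. *)

Set Implicit Arguments.
Unset Strict Implicit.
Unset Printing Implicit Defensive.

Import Order.TTheory GRing.Theory Num.Theory.
Local Open Scope ring_scope.

(** * Polynomial calculus *)

Section MPolyFacts.
Variables (k : fieldType) (n : nat).
Implicit Types (p q f g : {mpoly k[n]}) (A B : 'M[k]_n).

(** Associativity of substitution and the chain rule then need checking only on generators. *)
Lemma mpoly_alg_ind (P : {mpoly k[n]} -> Prop) :
  (forall c, P c%:MP) -> (forall i, P 'X_i) ->
  (forall p q, P p -> P q -> P (p + q)) ->
  (forall p q, P p -> P q -> P (p * q)) -> forall p, P p.
Proof.
move=> PC PX PD PM p.
have P0 : P 0 by rewrite -(mpolyC0 n k).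
have P1 : P 1 by rewrite -(mpolyC1 n k).
rewrite [p]mpolyE; apply: (big_ind P P0 PD) => m _.
rewrite -mul_mpolyC; apply: (PM) => //; rewrite mpolyXE_id.
apply: (big_ind P P1 PM) => i _; elim: {m}(m i) => [|e IH]; first by rewrite expr0.
by rewrite exprS; apply: (PM).
Qed.

Lemma mderivXU i j : mderiv i 'X_j = (j == i)%:R :> {mpoly k[n]}.
Proof.
rewrite mderivX mnm1E; case: eqVneq => [->|_]; last by rewrite scale0r.
by rewrite scale1r -[X in (X - _)%MM]add0m addmK mpolyX0.
Qed.

Lemma comp_mpolyA p (q r : n.-tuple {mpoly k[n]}) :
  (p \mPo q) \mPo r = p \mPo [tuple tnth q i \mPo r | i < n].
Proof.
move: p; apply: mpoly_alg_ind => [c|i|p1 p2 IH1 IH2|p1 p2 IH1 IH2].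
- by rewrite !comp_mpolyC.
- by rewrite !comp_mpolyXU -!tnth_nth tnth_mktuple.
- by rewrite !comp_mpolyD IH1 IH2.
- by rewrite !rmorphM /= IH1 IH2.
Qed.

Lemma mderiv_comp_mpoly j p (q : n.-tuple {mpoly k[n]}) :
  mderiv j (p \mPo q) = \sum_i (mderiv i p \mPo q) * mderiv j (tnth q i).
Proof.
move: p; apply: mpoly_alg_ind => [c|i|p1 p2 IH1 IH2|p1 p2 IH1 IH2].
- by rewrite comp_mpolyC mderivC big1 // => i _; rewrite mderivC comp_mpoly0 mul0r.
- rewrite comp_mpolyXU -tnth_nth (bigD1 i) //= big1 => [|l neq_li].
    by rewrite mderivXU eqxx comp_mpoly1 mul1r addr0.
  by rewrite mderivXU eq_sym (negPf neq_li) comp_mpoly0 mul0r.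
- rewrite comp_mpolyD mderivD IH1 IH2 -big_split /=; apply: eq_bigr => i _.
  by rewrite mderivD comp_mpolyD mulrDl.
- rewrite !rmorphM /= mderivM IH1 IH2 mulr_suml mulr_sumr -big_split /=.
  apply: eq_bigr => i _; rewrite mderivM comp_mpolyD !rmorphM /= mulrDl.
  by rewrite mulrAC mulrA.
Qed.

Lemma tnth_lin_subst A i : tnth (lin_subst A) i = \sum_j A i j *: 'X_j.
Proof. by rewrite tnth_mktuple. Qed.

Lemma lin_substM f A B :
  (f \mPo lin_subst A) \mPo lin_subst B = f \mPo lin_subst (A *m B).
Proof.
rewrite comp_mpolyA; congr (_ \mPo _); apply: eq_from_tnth => i.
rewrite tnth_mktuple !tnth_lin_subst rmorph_sum /=.
under eq_bigr => j _ do
  rewrite comp_mpolyZ comp_mpolyXU -tnth_nth tnth_lin_subst scaler_sumr.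
rewrite exchange_big /=; apply: eq_bigr => l _; rewrite mxE scaler_suml.
by apply: eq_bigr => j _; rewrite scalerA.
Qed.

Lemma lin_subst1 f : f \mPo lin_subst 1%:M = f.
Proof.
rewrite -[RHS]comp_mpoly_id; congr (_ \mPo _); apply: eq_from_tnth => i.
rewrite tnth_lin_subst tnth_mktuple (bigD1 i) //= mxE eqxx scale1r big1 ?addr0 //.
by move=> j ne_ji; rewrite mxE eq_sym (negPf ne_ji) scale0r.
Qed.

Lemma lin_substK A f : A \in unitmx ->
  (f \mPo lin_subst A) \mPo lin_subst (invmx A) = f.
Proof. by move=> uA; rewrite lin_substM mulmxV // lin_subst1. Qed.

Lemma lin_substVK A f : A \in unitmx ->
  (f \mPo lin_subst (invmx A)) \mPo lin_subst A = f.
Proof. by move=> uA; rewrite lin_substM mulVmx // lin_subst1. Qed.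

Lemma dhomog_lin_subst e f A : f \is e.-homog -> f \mPo lin_subst A \is e.-homog.
Proof.
move=> hf; rewrite comp_mpolyEX big_seq; apply: rpred_sum => m mf.
apply: rpredZ; rewrite comp_mpolyX -(dhomog_mf hf mf) /= mdegE.
apply: (big_ind2 (fun (p : {mpoly k[n]}) e => p \is e.-homog)).
- exact: dhomog1.
- by move=> p1 e1 p2 e2; exact: dhomogM.
move=> i _; rewrite -[X in X.-homog]mul1n; apply: dhomogMn.
rewrite tnth_lin_subst; apply: rpred_sum => j _; apply: rpredZ.
by rewrite dhomogX /= mdeg1.
Qed.

Lemma dhomog_mderiv e f i : f \is e.+1.-homog -> mderiv i f \is e.-homog.
Proof.
move/dhomogP=> hf; apply/dhomogP => m; rewrite mcoeff_msupp mcoeff_deriv => nz.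
have /hf : (m + U_(i))%MM \in msupp f.
  by rewrite mcoeff_msupp; apply: contraNneq nz => ->; rewrite mul0rn.
by rewrite /= mdegD mdeg1 addn1 => -[].
Qed.

Lemma dhomog_euler e f : f \is e.-homog ->
  \sum_i 'X_i * mderiv i f = e%:R *: f.
Proof.
move=> hf; rewrite {2}[f]mpolyE scaler_sumr.
under eq_bigr => i _ do rewrite {1}[f]mpolyE raddf_sum mulr_sumr /=.
rewrite exchange_big big_seq [RHS]big_seq /=; apply: eq_bigr => m mf.
rewrite -(dhomog_mf hf mf) /= mdegE natr_sum scaler_suml.
apply: eq_bigr => i _; rewrite mderivZ mderivX -!scalerAr !scalerA mulrC.
have [->|nz] := eqVneq (m i) 0%N; first by rewrite mul0r !scale0r.
rewrite -mpolyXD; congr (_ *: 'X_[_]); rewrite addmC submK //.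
by apply/mnm_lepP=> j; rewrite mnm1E; case: eqVneq => // <-; rewrite lt0n.
Qed.

End MPolyFacts.

(** * Gradients and Hessians *)

Local Notation "A ^:MP" := (map_mx (@mpolyC _ _) A)
  (at level 2, format "A ^:MP") : ring_scope.

Definition gradv (k : fieldType) (n : nat) (f : {mpoly k[n]}) :
  'cV[{mpoly k[n]}]_n := \col_i mderiv i f.

Definition hess (k : fieldType) (n : nat) (f : {mpoly k[n]}) :
  'M[{mpoly k[n]}]_n := \matrix_(i, j) mderiv i (mderiv j f).

(** A matrix witness for the inclusion of gradient spans, which makes the algebra [k[M]]
    available. *)
Definition grad_rel (k : fieldType) (n : nat) (M : 'M[k]_n) (f g : {mpoly k[n]}) :=
  gradv g = M^:MP *m gradv f.

(** Symmetry of [K (Hess f)], written as a commutation because [hess f] is itself symmetric; this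
    shape passes to polynomials in [K]. *)
Definition hess_sym (k : fieldType) (n : nat) (f : {mpoly k[n]}) (K : 'M[k]_n) :=
  K^:MP *m hess f = hess f *m K^T^:MP.

Section Gradient.
Variables (k : fieldType) (n : nat).
Implicit Types (f g h : {mpoly k[n]}) (A M K : 'M[k]_n).

Lemma gradvD f g : gradv (f + g) = gradv f + gradv g.
Proof. by apply/colP => i; rewrite !mxE mderivD. Qed.

Lemma gradvZ c f : gradv (c *: f) = c%:MP *: gradv f.
Proof. by apply/colP => i; rewrite !mxE mderivZ mul_mpolyC. Qed.

Lemma mul_gradvE m (A : 'M[k]_(m, n)) f i :
  (A^:MP *m gradv f) i 0 = \sum_j A i j *: mderiv j f.
Proof. by rewrite mxE; apply: eq_bigr => j _; rewrite !mxE mul_mpolyC. Qed.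

Lemma grad_relP M f g :
  grad_rel M f g <-> forall i, mderiv i g = \sum_j M i j *: mderiv j f.
Proof.
split=> [H i|H]; first by rewrite -mul_gradvE -H mxE.
by apply/colP => i; rewrite mul_gradvE -H mxE.
Qed.

Lemma grad_relD M N f g h :
  grad_rel M f g -> grad_rel N f h -> grad_rel (M + N) f (g + h).
Proof. by rewrite /grad_rel gradvD => -> ->; rewrite map_mxD mulmxDl. Qed.

Lemma grad_relZ c M f g : grad_rel M f g -> grad_rel (c *: M) f (c *: g).
Proof. by rewrite /grad_rel gradvZ => ->; rewrite map_mxZ scalemxAl. Qed.

Lemma grad_rel1 f : grad_rel 1%:M f f.
Proof. by rewrite /grad_rel map_mx1 mul1mx. Qed.

Lemma concise_mulmx_inj m (A : 'M[k]_(m, n)) f :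
  concise f -> A^:MP *m gradv f = 0 -> A = 0.
Proof.
move=> cf A0; apply/matrixP => i j; rewrite [RHS]mxE.
by apply: (cf (A i)); rewrite -mul_gradvE A0 mxE.
Qed.

Lemma mulmx_inj_concise f :
  (forall v : 'rV[k]_n, v^:MP *m gradv f = 0 -> v = 0) -> concise f.
Proof.
move=> inj_f c c0 i; have -> : c i = (\row_j c j) 0 i by rewrite mxE.
suff -> : \row_j c j = 0 by rewrite mxE.
apply: inj_f; apply/matrixP => a b; rewrite !ord1 mul_gradvE [RHS]mxE -[RHS]c0.
by apply: eq_bigr => j _; rewrite mxE.
Qed.

(** A row vector killed by [M] would give a linear relation among the partials of [g]. *)
Lemma grad_rel_unitmx M f g : grad_rel M f g -> concise g -> M \in unitmx.
Proof.
move=> rel cg; rewrite -row_free_unit; apply: inj_row_free => v vM0.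
by apply: (concise_mulmx_inj cg); rewrite rel mulmxA -map_mxM vM0 map_mx0 mul0mx.
Qed.

Lemma grad_rel_concise M f g :
  M \in unitmx -> grad_rel M f g -> concise f -> concise g.
Proof.
move=> uM rel cf; apply: mulmx_inj_concise => v.
rewrite rel mulmxA -map_mxM => /(concise_mulmx_inj cf) vM0.
by rewrite -[v](mulmxK uM) vM0 mul0mx.
Qed.

Lemma grad_rel_span M f g p : grad_rel M f g -> grad_span g p -> grad_span f p.
Proof.
move/grad_relP=> rel [c ->]; exists (fun j => \sum_i c i * M i j).
under eq_bigr => i _ do rewrite rel scaler_sumr.
rewrite exchange_big; apply: eq_bigr => j _; rewrite scaler_suml.
by apply: eq_bigr => i _; rewrite scalerA.
Qed.

Lemma grad_rel_inv M f g :
  M \in unitmx -> grad_rel M f g -> grad_rel (invmx M) g f.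
Proof.
by move=> uM rel; rewrite /grad_rel rel mulmxA -map_mxM mulVmx // map_mx1 mul1mx.
Qed.

Lemma grad_rel_same_grad M f g :
  M \in unitmx -> grad_rel M f g -> same_grad f g.
Proof.
move=> uM rel p; split; last exact: grad_rel_span rel.
by apply: grad_rel_span; exact: grad_rel_inv rel.
Qed.

Lemma same_grad_rel f g : same_grad f g -> exists M, grad_rel M f g.
Proof.
move=> sg.
have /fin_all_exists [c Hc] : forall i, exists c : 'I_n -> k,
    mderiv i g = \sum_j c j *: mderiv j f.
  move=> i; apply/sg; exists (fun j => (j == i)%:R).
  by rewrite (bigD1 i) //= eqxx scale1r big1 ?addr0 // => j /negPf->; rewrite scale0r.
exists (\matrix_(i, j) c i j); apply/grad_relP => i; rewrite Hc.
by apply: eq_bigr => j _; rewrite mxE.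
Qed.

Lemma gradv_lin_subst A f :
  gradv (f \mPo lin_subst A)
  = A^T^:MP *m map_mx (comp_mpoly (lin_subst A)) (gradv f).
Proof.
apply/colP => j; rewrite !mxE mderiv_comp_mpoly; apply: eq_bigr => i _.
rewrite !mxE mulrC; congr (_ * _); rewrite tnth_lin_subst raddf_sum (bigD1 j) //=.
rewrite mderivZ mderivXU eqxx big1 ?addr0 => [|l /negPf ne_lj].
  by rewrite -mul_mpolyC mulr1.
by rewrite mderivZ mderivXU ne_lj scaler0.
Qed.

Lemma map_mpolyC_comp m (B : 'M[k]_(m, n)) (q : n.-tuple {mpoly k[n]}) :
  map_mx (comp_mpoly q) B^:MP = B^:MP.
Proof. by apply/matrixP => i j; rewrite !mxE comp_mpolyC. Qed.

(** Substitution fixes the constant matrix [M], so the chain rule only conjugates it; this allows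
    [M] to be put in normal form. *)
Lemma grad_rel_lin_subst A M f g : A \in unitmx -> grad_rel M f g ->
  grad_rel (A^T *m M *m invmx A^T) (f \mPo lin_subst A) (g \mPo lin_subst A).
Proof.
move=> uA rel; rewrite /grad_rel !gradv_lin_subst rel map_mxM /= map_mpolyC_comp.
rewrite !mulmxA -!map_mxM.
by rewrite mulmxKV // unitmx_tr.
Qed.

Lemma concise_lin_subst A f :
  A \in unitmx -> concise f -> concise (f \mPo lin_subst A).
Proof.
move=> uA cf; apply: mulmx_inj_concise => v; rewrite gradv_lin_subst mulmxA -map_mxM.
(* The inverse substitution restores [gradv f] and leaves the constant coefficients unchanged. *)
move/(congr1 (map_mx (comp_mpoly (lin_subst (invmx A))))).
rewrite (map_mxM (comp_mpoly (lin_subst (invmx A)))) map_mpolyC_comp map_mx0.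
have -> : map_mx (comp_mpoly (lin_subst (invmx A)))
            (map_mx (comp_mpoly (lin_subst A)) (gradv f)) = gradv f.
  by apply/colP => i; rewrite !mxE lin_substK.
move/(concise_mulmx_inj cf) => vA0.
by rewrite -[v](@mulmxK _ _ _ A^T) ?unitmx_tr // vA0 mul0mx.
Qed.

Lemma hessC f i j : hess f i j = hess f j i.
Proof. by rewrite !mxE mderiv_comm. Qed.

Lemma hess_tr f : (hess f)^T = hess f.
Proof. by apply/matrixP => i j; rewrite mxE hessC. Qed.

Lemma hess_symP f K : hess_sym f K <-> (K^:MP *m hess f)^T = K^:MP *m hess f.
Proof. by rewrite /hess_sym trmx_mul hess_tr map_trmx; split=> /esym. Qed.

Lemma mul_hessE f K i j :
  (K^:MP *m hess f) i j = mderiv j (\sum_a K i a *: mderiv a f).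
Proof.
rewrite mxE raddf_sum; apply: eq_bigr => a _ /=.
by rewrite !mxE mul_mpolyC mderivZ mderiv_comm.
Qed.

(** [M (Hess f)] is the Hessian of [g]. *)
Lemma grad_rel_hess_sym f M g : grad_rel M f g -> hess_sym f M.
Proof.
move/grad_relP=> rel; apply/hess_symP/matrixP => i j.
by rewrite mxE !mul_hessE -!rel mderiv_comm.
Qed.

(* The form [x . K (grad f) / (d + 1)] is a potential of the closed
   vector field [K (grad f)], by Euler's formula. *)
Lemma hess_sym_potential d f K :
  d.+1%:R != 0 :> k -> f \is d.+1.-homog -> hess_sym f K ->
  exists2 g, g \is d.+1.-homog & grad_rel K f g.
Proof.
move=> nzd hf /hess_symP symK.
pose u i := \sum_a K i a *: mderiv a f.
have hu i : u i \is d.-homog.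
  by apply: rpred_sum => a _; apply/rpredZ/dhomog_mderiv.
have cu i j : mderiv j (u i) = mderiv i (u j).
  by rewrite -!mul_hessE -[in RHS]symK [RHS]mxE.
exists (d.+1%:R^-1 *: \sum_i 'X_i * u i).
  apply/rpredZ/rpred_sum => i _; rewrite -add1n; apply: dhomogM => //.
  by rewrite dhomogX /= mdeg1.
apply/grad_relP => j; rewrite mderivZ (raddf_sum (mderiv j)) /= -/(u j).
(* Closedness turns the [j]-th partial of the sum of [x_i u_i] into [u_j] plus the Euler sum of
   [u_j], that is [(d + 1) u_j]. *)
under eq_bigr => i _ do rewrite mderivM cu.
rewrite big_split /= (dhomog_euler (hu j)) (bigD1 j) //= big1 => [|i /negPf ne_ij].
  rewrite mderivXU eqxx mul1r addr0.
  by rewrite -{1}[u j]scale1r -scalerDl addrC natr1 scalerA mulVf ?scale1r.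
by rewrite mderivXU ne_ij mul0r.
Qed.

Lemma gradv_inj d f g : d.+1%:R != 0 :> k -> f \is d.+1.-homog -> g \is d.+1.-homog ->
  gradv f = gradv g -> f = g.
Proof.
move=> nzd hf hg eq_fg; apply: (scalerI nzd).
rewrite -(dhomog_euler hf) -(dhomog_euler hg); apply: eq_bigr => i _.
by move/colP/(_ i): eq_fg; rewrite !mxE => ->.
Qed.

Lemma mderiv_vars_in lo hi f (i : 'I_n) :
  vars_in lo hi f -> ~~ (lo <= i < hi)%N -> mderiv i f = 0.
Proof.
move=> vf Ni; apply/mpolyP => m; rewrite mcoeff_deriv mcoeff0.
have [/vf/(_ i)|/memN_msupp_eq0->] := boolP ((m + U_(i))%MM \in msupp f).
  by rewrite mnmDE mnm1E eqxx addn1 (negPf Ni) => /(_ isT).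
by rewrite mul0rn.
Qed.

End Gradient.

(** * Consequences of the assumption on the characteristic *)

Section Characteristic.
Variables (k : fieldType) (n d : nat).
Hypothesis charP : forall p : nat, p \in [pchar k] -> ~~ (p %| d.+1`!)%N.

Lemma natr_neq0_small j : (0 < j <= d.+1)%N -> j%:R != 0 :> k.
Proof.
move=> /andP[j0 jd]; apply/negP => j_eq0.
have [p pk] := natf0_pchar j0 j_eq0.
have := charP pk; rewrite (dvdn_trans _ (dvdn_fact (m := j) _)) ?j0 //.
by rewrite (dvdn_pcharf pk).
Qed.

(** The derivative has coefficient [m i] times [f@_m] at [m - U_(i)], and a nonzero [m i <= d + 1]
    is invertible in [k]. *)
Lemma mderiv_eq0_exponent (f : {mpoly k[n]}) i m :
  f \is d.+1.-homog -> mderiv i f = 0 -> m \in msupp f -> m i = 0%N.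
Proof.
move=> hf di0 mf; apply/eqP; apply: contraTT (mf) => nz.
have le_m : (U_(i) <= m)%MM.
  by apply/mnm_lepP=> j; rewrite mnm1E; case: eqVneq => // <-; rewrite lt0n.
move/(congr1 (mcoeff (m - U_(i)))): di0.
rewrite mcoeff_deriv submK // mcoeff0 mnmBE mnm1E eqxx subn1 prednK ?lt0n //.
move/eqP; rewrite -mulr_natr mulf_eq0 mcoeff_eq0 => /orP[-> //|].
apply: contraLR => _; apply: natr_neq0_small; rewrite lt0n nz /=.
by rewrite -(dhomog_mf hf mf) /= mdegE (bigD1 i) //= leq_addr.
Qed.

Lemma mderiv_eq0_vars_in lo hi (f : {mpoly k[n]}) : f \is d.+1.-homog ->
  (forall i : 'I_n, ~~ (lo <= i < hi)%N -> mderiv i f = 0) -> vars_in lo hi f.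
Proof.
move=> hf di0 m mf i; apply: contraNT => /di0 di.
by rewrite (mderiv_eq0_exponent hf di mf).
Qed.

End Characteristic.

(** * Matrix normal forms *)

(** Write the minimal polynomial as [q (X - a)^e] with [q(a)] nonzero. If [q] is constant, then
    [e > 1] and [(M - a)^(e-1)] has square zero; otherwise a Bezout relation yields the spectral
    idempotent of [a]. *)
Lemma horner_mx_idempotent_or_square0 (k : closedFieldType) n (M : 'M[k]_n.+1) :
  ~~ is_scalar_mx M ->
  exists p, let E := horner_mx M p in
    [/\ E *m E = E, E != 0 & E != 1%:M] \/ (E != 0 /\ E *m E = 0).
Proof.
rewrite -mxminpoly_linear_is_scalar -ltnNge => deg_gt1.
pose pM := mxminpoly M.
have szp : size pM = (degree_mxminpoly M).+1 by apply: size_mxminpoly.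
have nzp : pM != 0 by rewrite -size_poly_eq0 szp.
have [a ra] : exists a, root pM a.
  by apply/closed_rootP; rewrite szp; case: (degree_mxminpoly M) deg_gt1.
have [e [q]] := multiplicity_XsubC pM a; rewrite nzp /= => nqa def_p.
set x := ('X - a%:P) ^+ e in def_p *.
have e_gt0 : (0 < e)%N.
  case: e @x def_p => // x; rewrite /x expr0 mulr1 => eq_pq.
  by rewrite -eq_pq ra in nqa.
have szx : size x = e.+1 by rewrite /x size_exp_XsubC.
have [sq|sq] := leqP (size q) 1.
  have [c nzc def_q] : exists2 c, c != 0 & q = c%:P.
    exists q`_0; last exact: size1_polyC.
    by apply: contraNneq nqa => q0; rewrite (size1_polyC sq) q0 root0.
  have e_gt1 : (1 < e)%N.
    by move: deg_gt1; rewrite -ltnS -szp def_p def_q mul_polyC size_scale // szx.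
  exists (('X - a%:P) ^+ e.-1) => /=; right; split.
    rewrite -dvd_mxminpoly -/pM; apply/negP => /dvdp_leq.
    rewrite -size_poly_eq0 size_exp_XsubC prednK // -lt0n => /(_ e_gt0).
    by rewrite def_p def_q mul_polyC size_scale // szx ltnn.
  rewrite -[_ *m _](rmorphM (horner_mx M)) -exprD; apply/eqP.
  rewrite -dvd_mxminpoly -/pM def_p def_q mul_polyC dvdpZl //.
  by apply: dvdp_exp2l; lia.
have cop : coprimep x q.
  by rewrite coprimep_pexpl // coprimep_sym coprimep_XsubC.
have [[u v] /= uv1] := Bezout_eq1_coprimepP _ _ cop.
have vqE : v * q = 1 - u * x by rewrite -uv1 addrAC subrr add0r.
(* [v * q] is 1 modulo [x] and 0 modulo [q]; it acts neither as 0 nor as 1 because neither factor is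
   a unit. *)
exists (v * q) => /=; left; split.
- apply/eqP; rewrite -subr_eq0 -[_ *m _](rmorphM (horner_mx M)) -rmorphB.
  rewrite -dvd_mxminpoly -/pM def_p.
  have -> : v * q * (v * q) - v * q = - (v * u) * (q * x).
    rewrite -[X in _ - X]mulr1 -mulrBr {2}vqE addrAC subrr add0r mulrN mulNr.
    by rewrite mulrACA.
  by rewrite dvdp_mulIr.
- rewrite -dvd_mxminpoly -/pM; apply/negP => dp.
  have : x %| 1.
    have xp : x %| pM by rewrite def_p dvdp_mulIr.
    by rewrite -uv1 dvdp_add ?dvdp_mulIr // (dvdp_trans xp).
  by rewrite dvdp1 szx eqSS -leqn0 leqNgt e_gt0.
- rewrite -subr_eq0 -(horner_mx_C M 1) -rmorphB -dvd_mxminpoly -/pM polyC1.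
  apply/negP => dp; have : q %| 1.
    have qp : q %| pM by rewrite def_p dvdp_mulIl.
    have uxE : u * x = - (v * q - 1) by rewrite vqE opprB subKr.
    by rewrite -uv1 dvdp_add ?dvdp_mulIr // uxE dvdpNr (dvdp_trans qp).
  by rewrite dvdp1 => /eqP sq1; rewrite sq1 in sq.
Qed.

Section NormalForms.
Variable k : fieldType.

(** If [E = L D U] with [D] a partial identity, [E] is conjugate to [F = D U L]. Idempotence gives
    [F D = D], so [F] differs from [D] only in the upper right block. *)
Lemma idempotent_conj_pid n (E : 'M[k]_n) : E *m E = E ->
  exists2 P, P \in unitmx & P *m E = pid_mx (\rank E) *m P.
Proof.
move=> idE; set L := col_ebase E; set U := row_ebase E.
set D : 'M_n := pid_mx (\rank E).
have uL : L \in unitmx by apply: col_ebase_unit.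
have uU : U \in unitmx by apply: row_ebase_unit.
have defE : E = L *m D *m U by rewrite mulmx_ebase.
have DD : D *m D = D by rewrite pid_mx_id // rank_leq_row.
have DULD : D *m U *m L *m D = D.
  apply: (can_inj (mulKmx uL)); apply: (can_inj (mulmxK uU)).
  by rewrite -defE -[RHS]idE defE !mulmxA.
pose F := D *m U *m L.
have FD : F *m D = D by [].
have DF : D *m F = F by rewrite /F !mulmxA DD.
have FF : F *m F = F by rewrite {2}/F !mulmxA FD.
(* [F - D] has square zero, so [T] is unipotent, and [T F = F = D T] conjugates [F] to [D]. *)
pose T := 1%:M + (F - D).
have sq0 : (F - D) *m (F - D) = 0.
  by rewrite mulmxBl !mulmxBr FF FD DF DD subrr.
have uT : T \in unitmx.
  have [] // := @mulmx1_unit _ _ T (1%:M - (F - D)).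
  by rewrite mulmxDl mul1mx mulmxBr mulmx1 sq0 subr0 subrK.
have TF : T *m F = F by rewrite mulmxDl mul1mx mulmxBl FF DF subrr addr0.
have DT : D *m T = F by rewrite mulmxDr mulmx1 mulmxBr DF DD addrC subrK.
exists (T *m invmx L); first by rewrite unitmx_mul uT unitmx_inv.
rewrite mulmxA DT -TF [in LHS]defE !mulmxA mulmxKV //.
by rewrite mulmxK.
Qed.

(** An identity block in rows [0..l-1] and columns [l..2l-1]: the normal form of a square-zero
    matrix of rank [l]. *)
Definition shift_mx n l : 'M[k]_n :=
  \matrix_(i, j) ((i < l)%N && (j == l + i :> nat))%:R.

Lemma corner_conj_shift n r m (F : 'M[k]_n) : n = (r + m)%N ->
  pid_mx r *m F = F -> F *m (pid_mx r : 'M_n) = 0 -> \rank F = r ->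
  (r <= m)%N /\ exists2 P, P \in unitmx & P *m F = shift_mx n r *m P.
Proof.
move=> def_n; subst n; rewrite -[F]submxK pid_mx_block !mulmx_block.
rewrite !mul1mx !mul0mx !mulmx1 !mulmx0 !addr0.
case/eq_block_mx=> _ _ <- <-; set B := ursubmx F.
move/(congr1 ulsubmx); rewrite block_mxKul => F0.
have {F0}-> : ulsubmx F = 0 by rewrite F0; apply/matrixP => i j; rewrite !mxE.
rewrite block_mxEv row_mx0 rank_col_mx0 rank_row_0mx => rB.
split; first by rewrite -rB rank_leq_col.
have := mulmx_ebase B; rewrite rB; set L := col_ebase B; set U := row_ebase B => defB.
have uL : L \in unitmx by apply: col_ebase_unit.
have uU : U \in unitmx by apply: row_ebase_unit.
exists (block_mx (invmx L) 0 0 U).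
  by rewrite unitmxE det_ublock unitrM -!unitmxE unitmx_inv uL.
have -> : shift_mx (r + m) r = block_mx 0 (pid_mx r) 0 0.
  apply/matrixP => i j; rewrite [LHS]mxE.
  case: (splitP i) => i' Ei; case: (splitP j) => j' Ej.
  - have -> : i = lshift m i' by apply: val_inj.
    have -> : j = lshift m j' by apply: val_inj.
    rewrite block_mxEul [RHS]mxE /=; case: eqP => // E.
    by have := ltn_ord j'; rewrite E ltnNge leq_addr.
  - have -> : i = lshift m i' by apply: val_inj.
    have -> : j = rshift r j' by apply: val_inj.
    by rewrite block_mxEur [RHS]mxE /= eqn_add2l eq_sym ltn_ord andbT.
  - have -> : i = rshift r i' by apply: val_inj.
    have -> : j = lshift m j' by apply: val_inj.
    by rewrite block_mxEdl [RHS]mxE.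
  - have -> : i = rshift r i' by apply: val_inj.
    have -> : j = rshift r j' by apply: val_inj.
    by rewrite block_mxEdr [RHS]mxE.
rewrite -row_mx0 -block_mxEv !mulmx_block !mulmx0 !mul0mx !addr0 !add0r.
by rewrite -defB !mulmxA mulVmx // mul1mx.
Qed.

(** If [N = L D U], its conjugate [D U L] satisfies [D U L D = 0] and is thus confined to the upper
    right corner. *)
Lemma square0_conj_shift n (N : 'M[k]_n) : N *m N = 0 ->
  (\rank N <= n - \rank N)%N /\
  exists2 P, P \in unitmx & P *m N = shift_mx n (\rank N) *m P.
Proof.
move=> sqN; set L := col_ebase N; set U := row_ebase N.
pose D : 'M[k]_n := pid_mx (\rank N).
have uL : L \in unitmx by apply: col_ebase_unit.
have uU : U \in unitmx by apply: row_ebase_unit.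
have defN : N = L *m D *m U by rewrite mulmx_ebase.
have DD : D *m D = D by rewrite pid_mx_id // rank_leq_row.
have DULD : D *m U *m L *m D = 0.
  apply: (can_inj (mulKmx uL)); apply: (can_inj (mulmxK uU)).
  by rewrite mulmx0 mul0mx -[RHS]sqN defN !mulmxA.
have DF : D *m (D *m U *m L) = D *m U *m L by rewrite !mulmxA DD.
have rF : \rank (D *m U *m L) = \rank N.
  by rewrite !mxrankMfree ?row_free_unit // rank_pid_mx // rank_leq_row.
have := corner_conj_shift (esym (subnKC (rank_leq_row N))) DF DULD rF.
case=> le_r [P uP PF]; split=> //; exists (P *m invmx L).
  by rewrite unitmx_mul uP unitmx_inv.
by rewrite mulmxA -PF -!mulmxA mulmxV // mulmx1 defN !mulmxA mulmxKV.
Qed.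

End NormalForms.

(** * Direct sums and LDS forms *)

(** For [K] a polynomial in [M], [K M (Hess f) = K (Hess f) M^T = (Hess f) K^T M^T], and [K]
    commutes with [M]. *)
Lemma hess_sym_horner (k : fieldType) n (f : {mpoly k[n.+1]}) (M : 'M[k]_n.+1) p :
  hess_sym f M -> hess_sym f (horner_mx M p).
Proof.
rewrite /hess_sym => symM; elim/poly_ind: p => [|p c IH].
  by rewrite rmorph0 trmx0 !map_mx0 mulmx0 mul0mx.
rewrite rmorphD rmorphM /= horner_mx_X horner_mx_C.
have comm : horner_mx M p *m M = M *m horner_mx M p.
  by have := comm_horner_mx2 M p 'X; rewrite horner_mx_X.
rewrite linearD /= tr_scalar_mx.
have -> : (horner_mx M p * M)^T = (horner_mx M p)^T *m M^T.
  by rewrite [_ * _]comm trmx_mul.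
rewrite !map_mxD mulmxDl mulmxDr !map_mxM /= -mulmxA symM mulmxA IH -mulmxA.
congr (_ + _).
by rewrite map_scalar_mx scalar_mxC.
Qed.

(* A second form whose gradient span lies in that of [f]; conciseness is
   recovered generically on the pencil through [f]. *)
Definition has_companion (k : fieldType) (n d : nat) (f : {mpoly k[n]}) :=
  exists (M : 'M[k]_n) (g : {mpoly k[n]}),
    [/\ g \is d.+1.-homog, grad_rel M f g & forall c : k, g != c *: f].

Section DirectSumLDS.
Variables (k : fieldType) (n d : nat).
Hypothesis charP : forall p : nat, p \in [pchar k] -> ~~ (p %| d.+1`!)%N.
Implicit Types (f g F H G : {mpoly k[n]}).

Let nzd : d.+1%:R != 0 :> k.
Proof. by apply: (natr_neq0_small charP); rewrite leqnn. Qed.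

(** Let [g] have gradient [E (grad f)]. Once [E] is a partial identity, the gradient of [G] is the
    first [r] entries of that of [F], so [G] and [F - G] involve disjoint variables. Conciseness
    excludes zero summands. *)
Lemma idempotent_direct_sum f (E : 'M[k]_n) :
  f \is d.+1.-homog -> concise f -> hess_sym f E ->
  E *m E = E -> E != 0 -> E != 1%:M -> direct_sum d f.
Proof.
move=> hf cf symE idE nzE nz1E.
have [g hg rel] := hess_sym_potential nzd hf symE.
have [P uP PE] := idempotent_conj_pid idE.
set r := \rank E in PE.
have uA : P^T \in unitmx by rewrite unitmx_tr.
have := grad_rel_lin_subst uA rel; rewrite trmxK PE mulmxK //.
set F := f \mPo _; set G := g \mPo _ => relF.
have hF : F \is d.+1.-homog by apply: dhomog_lin_subst.
have hG : G \is d.+1.-homog by apply: dhomog_lin_subst.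
have cF : concise F by apply: concise_lin_subst.
have dG (i : 'I_n) : mderiv i G = (i < r)%N%:R *: mderiv i F.
  have /grad_relP -> := relF; rewrite (bigD1 i) //= big1 => [|j ne_ji].
    by rewrite mxE eqxx addr0.
  by rewrite mxE val_eqE eq_sym (negPf ne_ji) scale0r.
exists P^T, r, G, (F - G); split=> //; last by rewrite addrC subrK.
- split=> //.
    apply: contraNneq nzE => G0; move: relF; rewrite G0 /grad_rel => relF.
    have D0 : pid_mx r = 0 :> 'M[k]_n.
      apply: (concise_mulmx_inj cF); rewrite -relF.
      by apply/colP => i; rewrite !mxE mderiv0.
    by rewrite -[E](mulKmx uP) PE D0 mul0mx mulmx0.
  apply: (mderiv_eq0_vars_in charP hG) => i; rewrite leq0n /= => /negPf Ni.
  by rewrite dG Ni scale0r.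
- split; first exact: rpredB.
    apply: contraNneq nz1E => /eqP; rewrite subr_eq0 => /eqP FG.
    have D1 : 1%:M - pid_mx r = 0 :> 'M[k]_n.
      apply: (concise_mulmx_inj cF); rewrite map_mxB mulmxBl map_mx1 mul1mx.
      by rewrite -relF -FG subrr.
    move/eqP: D1; rewrite subr_eq0 => /eqP D1.
    by rewrite -[E](mulKmx uP) PE -D1 mul1mx mulVmx.
  apply: (mderiv_eq0_vars_in charP); first exact: rpredB.
  move=> i; rewrite ltn_ord andbT -ltnNge => lt_ir.
  by rewrite mderivB dG lt_ir scale1r subrr.
Qed.

(** The inner sum has at most one term; it avoids building the index [l + i] as an ordinal. *)
Definition lds_part (l : nat) (H : {mpoly k[n]}) : {mpoly k[n]} :=
  \sum_(i < n) \sum_(j < n | (i < l)%N && (j == l + i :> nat)) 'X_i * mderiv j H.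

Lemma dhomog_lds_part l H : H \is d.+1.-homog -> lds_part l H \is d.+1.-homog.
Proof.
move=> hH; apply: rpred_sum => i _; apply: rpred_sum => j _.
by rewrite -add1n; apply: dhomogM; [rewrite dhomogX /= mdeg1|apply: dhomog_mderiv].
Qed.

Lemma mderiv_lds_part l H (i : 'I_n) : vars_in l (l + l) H -> (i < l)%N ->
  mderiv i (lds_part l H) = \sum_(j < n | j == (l + i)%N :> nat) mderiv j H.
Proof.
move=> vH lt_il; have dH : mderiv i H = 0.
  by apply: mderiv_vars_in vH _; rewrite leqNgt lt_il.
rewrite (raddf_sum (mderiv i)) (bigD1 i) //= [X in _ + X]big1 ?addr0.
  rewrite (raddf_sum (mderiv i)) /= lt_il; apply: eq_bigr => j _.
  rewrite mderivM [mderiv i (mderiv j H)]mderiv_comm dH mderiv0 mulr0 addr0.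
  by rewrite mderivXU eqxx mul1r.
move=> i' /negPf ne_i; rewrite (raddf_sum (mderiv i)) big1 //= => j _.
rewrite mderivM [mderiv i (mderiv j H)]mderiv_comm dH mderiv0 mulr0 addr0.
by rewrite mderivXU ne_i mul0r.
Qed.

(** Let [g] have gradient [N (grad f)]. In suitable coordinates its transform [H] has [l + i]-th
    partial equal to the [i]-th partial of [F] for [i < l], and no others. Subtracting
    [lds_part l H] from [F] then kills the first [l] partials. *)
Lemma square0_LDS f (N : 'M[k]_n) :
  f \is d.+1.-homog -> concise f -> hess_sym f N ->
  N != 0 -> N *m N = 0 -> LDS d f.
Proof.
move=> hf cf symN nzN sqN.
have [g hg rel] := hess_sym_potential nzd hf symN.
(* The relation matrix wanted for [H] is a transposed shift, so the transpose of [N] is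
   normalized. *)
have sqNt : N^T *m N^T = 0 by rewrite -trmx_mul sqN trmx0.
have [] := square0_conj_shift sqNt; rewrite mxrank_tr.
set l := \rank N => le_l [P uP PN].
have uA : invmx P \in unitmx by rewrite unitmx_inv.
have le2 : (l + l <= n)%N by rewrite -leq_subRL ?rank_leq_row.
have := grad_rel_lin_subst uA rel.
have -> : (invmx P)^T *m N *m invmx (invmx P)^T = (shift_mx k n l)^T.
  rewrite trmx_inv invmxK; apply: (can_inj (mulmxK (_ : invmx P^T \in unitmx))).
    by rewrite unitmx_inv unitmx_tr.
  rewrite mulmxK ?unitmx_tr //; apply: (can_inj (mulKmx (_ : P^T \in unitmx))).
    by rewrite unitmx_tr.
  rewrite mulKVmx ?unitmx_tr // mulmxA -trmx_mul -PN trmx_mul trmxK.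
  by rewrite mulmxK ?unitmx_tr.
set F := f \mPo _; set H := g \mPo _ => /grad_relP relF.
have hF : F \is d.+1.-homog by apply: dhomog_lin_subst.
have hH : H \is d.+1.-homog by apply: dhomog_lin_subst.
have vH : vars_in l (l + l) H.
  apply: (mderiv_eq0_vars_in charP hH) => j Nj; rewrite relF big1 // => i _.
  rewrite !mxE; case: andP => [[lt_il /eqP Ej]|]; last by rewrite scale0r.
  by rewrite Ej leq_addr ltn_add2l lt_il in Nj.
have hG : F - lds_part l H \is d.+1.-homog by rewrite rpredB // dhomog_lds_part.
exists (invmx P), l, H, (F - lds_part l H); split=> //.
- by rewrite le_l lt0n mxrank_eq0 nzN.
- split=> //; apply: (mderiv_eq0_vars_in charP hG) => i.
  rewrite ltn_ord andbT -ltnNge => lt_il; rewrite mderivB mderiv_lds_part //.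
  have lt_j : (l + i < n)%N by apply: leq_trans le2; rewrite ltn_add2l.
  rewrite (big_pred1 (Ordinal lt_j)) // relF (bigD1 i) //= !mxE lt_il /= eqxx.
  rewrite scale1r big1 ?addr0 ?subrr // => a ne_ai; rewrite !mxE /= eqn_add2l.
  by rewrite eq_sym val_eqE (negPf ne_ai) andbF scale0r.
- by rewrite addrC subrK.
Qed.

Lemma has_companion_lin_subst f (A : 'M[k]_n) : A \in unitmx ->
  has_companion d (f \mPo lin_subst A) -> has_companion d f.
Proof.
move=> uA [M [g [hg rel Nfg]]].
have uA' : invmx A \in unitmx by rewrite unitmx_inv.
have := grad_rel_lin_subst uA' rel; rewrite lin_substK // => rel'.
eexists; exists (g \mPo lin_subst (invmx A)); split; last 2 first.
- exact: rel'.
- move=> c; apply/eqP => /(congr1 (comp_mpoly (lin_subst A))).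
  by rewrite lin_substVK // comp_mpolyZ; apply/eqP/Nfg.
exact: dhomog_lin_subst.
Qed.

(** The summand [f1] works, with a coordinate projection as matrix. If [f1 = c (f1 + f2)], the
    leading monomial of [f2] gives [c = 0]. *)
Lemma direct_sum_companion f : direct_sum d f -> has_companion d f.
Proof.
case=> A [m [f1 [f2 [uA [h1 nz1 v1] [h2 nz2 v2] defF]]]].
apply: (has_companion_lin_subst uA); rewrite defF.
exists (diag_mx (\row_i (i < m)%N%:R)), f1; split=> // [|c].
  apply/grad_relP => i; rewrite (bigD1 i) //= !mxE eqxx mulr1n big1 => [|j ne_ji].
    rewrite addr0 mderivD; have [lt_im|ge_im] := ltnP i m.
      by rewrite (mderiv_vars_in v2) ?addr0 ?scale1r // leqNgt lt_im.
    by rewrite scale0r (mderiv_vars_in v1) //= -leqNgt.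
  by rewrite !mxE eq_sym (negPf ne_ji) mulr0n scale0r.
(* Monomials of [f1] and [f2] involve disjoint nonempty sets of variables. *)
have disj x : x \in msupp f1 -> x \in msupp f2 -> False.
  move=> x1 x2; have: mdeg x != 0%N by rewrite (dhomog_mf h1 x1).
  rewrite mdegE; apply/negP; rewrite negbK big1 // => i _; apply/eqP.
  apply: contraT => nzi; have := v1 _ x1 _ nzi; have := v2 _ x2 _ nzi.
  by rewrite leqNgt => /andP[/negPf->].
apply/negP => /eqP Ef.
have : mlead f2 \in msupp f2 by apply: mlead_supp.
have : mlead f1 \in msupp f1 by apply: mlead_supp.
move=> s1 s2; have := congr1 (mcoeff (mlead f2)) Ef.
have /memN_msupp_eq0 -> : mlead f2 \notin msupp f1 by apply/negP => /disj/(_ s2).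
rewrite mcoeffZ mcoeffD (memN_msupp_eq0 (p := f1)) ?add0r; last first.
  by apply/negP => /disj/(_ s2).
move/esym/eqP; rewrite mulf_eq0 mcoeff_eq0 s2 orbF => /eqP c0.
by rewrite Ef c0 scale0r eqxx in nz1.
Qed.

(** [H] works, with a transposed shift as matrix. If [H = c F], then [c = 0], because [H] omits the
    variable 0 while [F] involves it; so [H = 0], yet the 0-th partial of [F] is the [l]-th partial
    of [H]. *)
Lemma LDS_companion f : concise f -> LDS d f -> has_companion d f.
Proof.
move=> cf [A [l [H [G [uA /andP[l_gt0 le_l] [hH vH] [hG vG] defF]]]]].
apply: (has_companion_lin_subst uA).
have cF := concise_lin_subst uA cf.
move: cF; rewrite -/(lds_part l H) in defF; rewrite defF; set F := _ + G => cF.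
have le2 : (l + l <= n)%N.
  by rewrite -leq_subRL // (leq_trans le_l) // leq_subr.
have dF (i : 'I_n) : (i < l)%N ->
    mderiv i F = \sum_(j < n | j == (l + i)%N :> nat) mderiv j H.
  move=> lt_il; rewrite mderivD mderiv_lds_part // (mderiv_vars_in vG) ?addr0 //.
  by rewrite leqNgt lt_il.
have dF' (i j : 'I_n) : (i < l)%N -> j = (l + i)%N :> nat -> mderiv i F = mderiv j H.
  move=> lt_il Ej; rewrite dF // (big_pred1 j) // => a.
  by rewrite /= -Ej val_eqE.
exists (shift_mx k n l)^T, H; split=> // [|c].
  apply/grad_relP => j; have [/andP[le_lj lt_jl]|Nj] := boolP (l <= j < l + l)%N.
    have lt_i : (j - l < n)%N by apply: leq_ltn_trans (leq_subr _ _) _.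
    have [i Ej] : exists i : 'I_n, j = (l + i)%N :> nat.
      by exists (Ordinal lt_i); rewrite /= subnKC.
    have lt_il : (i < l)%N by rewrite Ej ltn_add2l in lt_jl.
    rewrite (bigD1 i) //= !mxE Ej eqxx lt_il scale1r big1 ?addr0 => [|a ne_ai].
      by rewrite (dF' _ j).
    by rewrite !mxE Ej eqn_add2l eq_sym val_eqE (negPf ne_ai) andbF scale0r.
  rewrite (mderiv_vars_in vH) // big1 // => i _; rewrite !mxE.
  case: andP => [[lt_il /eqP Ej]|]; last by rewrite scale0r.
  by rewrite Ej leq_addr ltn_add2l lt_il in Nj.
apply/negP => /eqP EH.
have n_gt0 : (0 < n)%N by apply: leq_trans le2; rewrite addn_gt0 l_gt0.
have lt_ln : (l < n)%N by apply: leq_trans le2; rewrite -addn1 leq_add2l.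
pose i0 := Ordinal n_gt0.
have nz_dF : mderiv i0 F != 0.
  apply/eqP => dF0; suff /cF/(_ i0)/eqP : \sum_i (i == i0)%:R *: mderiv i F = 0.
    by rewrite eqxx oner_eq0.
  rewrite (bigD1 i0) //= dF0 scaler0 add0r big1 // => i /negPf->.
  by rewrite scale0r.
have : c *: mderiv i0 F = 0.
  by rewrite -mderivZ -EH (mderiv_vars_in vH) //= leqNgt l_gt0.
move/eqP; rewrite scaler_eq0 (negPf nz_dF) orbF => /eqP c0.
case/eqP: nz_dF; rewrite (dF' _ (Ordinal lt_ln)) //= ?addn0 //.
by rewrite EH c0 scale0r mderiv0.
Qed.

End DirectSumLDS.

(** [M] is not scalar, for otherwise [g] and a multiple of [f] would have the same gradient. *)
Lemma companion_direct_sum_or_LDS (k : closedFieldType) n d (f : {mpoly k[n]}) :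
  (forall p : nat, p \in [pchar k] -> ~~ (p %| d.+1`!)%N) ->
  f \is d.+1.-homog -> concise f -> has_companion d f ->
  direct_sum d f \/ LDS d f.
Proof.
move=> charP hf cf [M [g [hg rel Nfg]]].
have nzd : d.+1%:R != 0 :> k by apply: (natr_neq0_small charP); rewrite leqnn.
have NsM : ~~ is_scalar_mx M.
  apply/negP => /is_scalar_mxP[a defM]; case/eqP: (Nfg a).
  apply: (gradv_inj nzd) => //; first exact: rpredZ.
  by rewrite rel defM map_scalar_mx mul_scalar_mx gradvZ.
(* [horner_mx] requires a positive size; in size zero every matrix is scalar. *)
case: n f hf cf M g hg rel Nfg NsM => [|n] f hf cf M g hg rel Nfg NsM.
  by case/is_scalar_mxP: NsM; exists 0; rewrite flatmx0 [RHS]flatmx0.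
have [p] := horner_mx_idempotent_or_square0 NsM.
have := hess_sym_horner p (grad_rel_hess_sym rel).
move: (horner_mx M p) => E symE [[idE nz nz1]|[nz sq]]; [left|right].
  exact: idempotent_direct_sum symE _ _ _.
exact: square0_LDS symE _ _.
Qed.

(** * Fibers of the gradient map *)

(** Restriction to a curve reduces generic nonvanishing to finding a non-root of a univariate
    polynomial. *)
Lemma meval_path (k : fieldType) N (P : {mpoly k[N]}) (q : 'I_N -> {poly k}) :
  exists r : {poly k}, forall t, r.[t] = P.@[fun j => (q j).[t]].
Proof.
exists (mmap polyC q P) => t; rewrite mevalE /mmap horner_sum.
apply: eq_bigr => m _; rewrite hornerM hornerC horner_prod; congr (_ * _).
by apply: eq_bigr => i _; rewrite horner_exp.
Qed.

Lemma det_path (k : fieldType) n (A B : 'M[k]_n) :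
  exists r : {poly k}, forall t, r.[t] = \det (A + t *: B).
Proof.
exists (\det (map_mx polyC A + 'X *: map_mx polyC B)) => t.
rewrite -[LHS]/(horner_eval t _) -det_map_mx; congr (\det _).
by apply/matrixP => i j; rewrite !mxE /= /horner_eval !hornerE.
Qed.

Lemma dhomog_meval_scale (k : fieldType) N e (P : {mpoly k[N]}) (v : 'I_N -> k) c :
  P \is e.-homog -> P.@[fun j => c * v j] = c ^+ e * P.@[v].
Proof.
move=> hP; rewrite !mevalE mulr_sumr big_seq [RHS]big_seq; apply: eq_bigr => m mP.
rewrite mulrCA; congr (_ * _); rewrite -(dhomog_mf hP mP) /= mdegE.
by rewrite -prodrXr -big_split /=; apply: eq_bigr => i _; rewrite exprMn.
Qed.

Lemma dhomog_nvars_gt0 (k : fieldType) n d (f : {mpoly k[n]}) :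
  f \is d.+1.-homog -> f != 0 -> (0 < n)%N.
Proof.
move=> hf /mlead_supp mf; have := dhomog_mf hf mf; rewrite /= mdegE.
by case: n f hf mf => // f _ _; rewrite big_ord0.
Qed.

Lemma concise_neq0 (k : fieldType) n (f : {mpoly k[n]}) :
  (0 < n)%N -> concise f -> f != 0.
Proof.
move=> n_gt0 cf; apply/eqP => f0.
suff /cf/(_ (Ordinal n_gt0))/eqP : \sum_(i < n) 1 *: mderiv i f = 0.
  by rewrite oner_eq0.
by rewrite f0 big1 // => i _; rewrite mderiv0 scaler0.
Qed.

(** * Zariski closed sets of forms *)

Section Zariski.
Variables (k : fieldType) (n d : nat).
Implicit Types (f g h : {mpoly k[n]}) (C : {mpoly k[n]} -> Prop).

Lemma coordsZ c f j : @coords k n d (c *: f) j = c * @coords k n d f j.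
Proof. by rewrite /coords mcoeffZ. Qed.

Lemma coords_line_path (P : {mpoly k[ncoord n d]}) f h :
  exists r : {poly k}, forall t, r.[t] = P.@[@coords k n d (f + t *: h)].
Proof.
have [r Er] := meval_path P (fun j => (@coords k n d f j)%:P + @coords k n d h j *: 'X).
exists r => t; rewrite Er; apply: meval_eq => j.
by rewrite !hornerE /coords mcoeffD mcoeffZ mulrC.
Qed.

Lemma zclosed_scale C f c : zclosed d C -> C f -> C (c *: f).
Proof.
case=> Ps [hPs defC] /defC Cf; apply/defC => P PsP; have [e hP] := hPs _ PsP.
rewrite (meval_eq (v2 := fun j => c * @coords k n d f j)); last exact: coordsZ.
by rewrite (dhomog_meval_scale _ _ hP) (Cf _ PsP) mulr0.
Qed.

(** An equation of [C] that fails at [g], chosen classically, defines a basic open neighbourhood. *)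
Lemma zclosed_avoid C g : zclosed d C -> ~ C g ->
  exists2 P : {mpoly k[ncoord n d]}, P.@[@coords k n d g] != 0 &
    forall x, P.@[@coords k n d x] != 0 -> ~ C x.
Proof.
case=> Ps [_ defC] NCg.
have [P NP] : exists P, ~ (Ps P -> P.@[@coords k n d g] = 0).
  by apply: not_all_ex_not => H; apply/NCg/defC.
have [PsP nzP] := imply_to_and _ _ NP.
exists P; first exact/eqP.
by move=> x /eqP nz /defC/(_ P PsP).
Qed.

Lemma zclosed0 : zclosed d (fun _ : {mpoly k[n]} => False).
Proof.
exists (fun P => P = 1); split=> [P ->|g]; first by exists 0%N; apply: dhomog1.
by split=> // /(_ _ erefl)/eqP; rewrite meval1 oner_eq0.
Qed.

Lemma zclosedT : zclosed d (fun _ : {mpoly k[n]} => True).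
Proof. by exists (fun P => False); split. Qed.

(** Two-by-two minors: linear equations in [g] that cut out the projective point of [f]. *)
Definition coords_proportional f g :=
  forall i j : 'I_(ncoord n d), coords f j * coords g i = coords f i * coords g j.

Lemma zclosed_coords_proportional f : zclosed d (coords_proportional f).
Proof.
exists (fun P => exists i j, P = @coords k n d f j *: 'X_i - @coords k n d f i *: 'X_j).
split=> [P [i [j ->]]|g].
  by exists 1%N; apply: rpredB; apply: rpredZ; rewrite dhomogX /= mdeg1.
split=> [pfg P [i [j ->]]|vP i j].
  by rewrite mevalB !mevalZ !mevalXU pfg subrr.
have /eqP := vP _ (ex_intro _ i (ex_intro _ j erefl)).
by rewrite mevalB !mevalZ !mevalXU subr_eq0 => /eqP.
Qed.

Lemma coords_proportionalP f g :
  f \is d.+1.-homog -> g \is d.+1.-homog -> f != 0 ->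
  coords_proportional f g <-> exists c, g = c *: f.
Proof.
move=> hf hg nzf; split=> [pfg|[c ->] i j]; last first.
  by rewrite !coordsZ mulrCA [RHS]mulrCA [_ * @coords k n d f i]mulrC.
have coordE (h : {mpoly k[n]}) m (lt_m : (mdeg m < d.+2)%N) :
    h@_m = @coords k n d h (enum_rank (BMultinom lt_m)).
  by rewrite /coords enum_rankK.
have mf := mlead_supp nzf; set m := mlead f in mf.
have lt_m : (mdeg m < d.+2)%N by rewrite (dhomog_mf hf mf).
have nzm : f@_m != 0 by rewrite -mcoeff_msupp.
exists (g@_m / f@_m); apply/mpolyP => m'; rewrite mcoeffZ.
have [dm'|Ndm'] := eqVneq (mdeg m') d.+1; last first.
  by rewrite (dhomog_nemf_coeff hg Ndm') (dhomog_nemf_coeff hf Ndm') mulr0.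
have lt_m' : (mdeg m' < d.+2)%N by rewrite dm'.
apply: (mulfI nzm); rewrite mulrA [_ * (_ / _)]mulrC divfK // [g@_m * _]mulrC.
by rewrite !(coordE _ _ lt_m) !(coordE _ _ lt_m') pfg.
Qed.

End Zariski.

(** * Lines and irreducibility in a gradient fiber *)

Section Fiber.
Variables (k : closedFieldType) (n d : nat).
Implicit Types (f g h x : {mpoly k[n]}).

(** Conciseness of [g] forces [M] to be invertible; conversely an invertible [M] carries conciseness
    from [f] to [g]. *)
Lemma grad_fiberP f g : concise f -> f != 0 -> f \is d.+1.-homog ->
  grad_fiber d f g <->
  exists M, [/\ M \in unitmx, g \is d.+1.-homog & grad_rel M f g].
Proof.
move=> cf nzf hf; split=> [[[hg nzg cg] sg]|[M [uM hg rel]]].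
  have [|M rel] := @same_grad_rel _ _ f g; first by move=> p; have := sg p; tauto.
  by exists M; split=> //; apply: grad_rel_unitmx rel cg.
have cg := grad_rel_concise uM rel cf.
split; first by split=> //; apply: concise_neq0 cg; apply: dhomog_nvars_gt0 hf nzf.
by apply: grad_rel_same_grad (grad_rel_inv uM rel); rewrite unitmx_inv.
Qed.

Lemma companion_grad_not_injective f : f \is d.+1.-homog -> f != 0 -> concise f ->
  has_companion d f -> grad_not_injective d f.
Proof.
move=> hf nzf cf [M [g [hg rel Nfg]]].
have [r Er] := det_path 1%:M M.
(* The form [f + t g] has matrix [1 + t M]; a non-root of [r * 'X] is a nonzero [t] making it
   invertible. *)
have nzr : r * 'X != 0.
  rewrite mulf_neq0 ?polyX_eq0 //; apply: contra_eq_neq (Er 0) => ->.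
  by rewrite horner0 scale0r addr0 det1 eq_sym oner_neq0.
have /closed_nonrootP[t] := nzr; rewrite rootE hornerM hornerX Er mulf_eq0.
rewrite negb_or => /andP[nzdet nzt].
have uMt : 1%:M + t *: M \in unitmx by rewrite unitmxE unitfE.
have relt := grad_relD (grad_rel1 f) (grad_relZ t rel).
have ht : f + t *: g \is d.+1.-homog by rewrite rpredD // rpredZ.
have /(grad_fiberP _ cf nzf hf)[dom sg] :
    exists M, [/\ M \in unitmx, f + t *: g \is d.+1.-homog & grad_rel M f (f + t *: g)].
  by exists (1%:M + t *: M).
exists (f + t *: g); split=> //; last by move=> p; have := sg p; tauto.
move=> c; apply/eqP => Ec; case/eqP: (Nfg (t^-1 * (c - 1))).
by rewrite -scalerA scalerBl scale1r -Ec addrAC subrr add0r scalerA mulVf // scale1r.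
Qed.

Lemma grad_not_injective_companion f : grad_not_injective d f -> has_companion d f.
Proof.
case=> g [[hg _ _] Nfg /same_grad_rel[M rel]]; by exists M, g.
Qed.

(** The line through [g] in direction [h] leaves [U] only at roots of [det (N + t M)] times an
    equation of the removed closed set. *)
Lemma grad_fiber_open_line f U g h (M : 'M[k]_n) :
  f \is d.+1.-homog -> f != 0 -> concise f -> open_in d (grad_fiber d f) U ->
  U g -> h \is d.+1.-homog -> grad_rel M f h ->
  exists2 r : {poly k}, r.[0] != 0 & forall t, r.[t] != 0 -> U (g + t *: h).
Proof.
move=> hf nzf cf [C [zC defU]] /defU[] fib NCg hh relh.
have /(grad_fiberP _ cf nzf hf)[N [uN hg relg]] := fib.
have [P nzP avoid] := zclosed_avoid zC NCg.
have [r1 E1] := det_path N M; have [r2 E2] := coords_line_path P g h.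
exists (r1 * r2) => [|t]; rewrite hornerM mulf_eq0 E1 E2 negb_or.
  by rewrite !scale0r !addr0 nzP andbT -unitfE -unitmxE.
case/andP=> nzdet nzPt; apply/defU; split; last exact: avoid.
apply/(grad_fiberP _ cf nzf hf); exists (N + t *: M); split.
- by rewrite unitmxE unitfE.
- by rewrite rpredD // rpredZ.
- exact: grad_relD relg (grad_relZ t relh).
Qed.

(** Join a point outside [Z1] to a point outside [Z2]: a general point of the line lies in [U] and
    outside both. *)
Lemma open_in_grad_fiber_irreducible f U :
  f \is d.+1.-homog -> f != 0 -> concise f -> open_in d (grad_fiber d f) U ->
  U f -> irred_space d U.
Proof.
move=> hf nzf cf oU Uf; split=> [|Z1 Z2 [C1 [zC1 def1]] [C2 [zC2 def2]] cover].
  by exists f.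
apply: NNPP => /not_or_and[N1 N2].
have [g1 {}N1] := not_all_ex_not _ _ N1; have [U1 NZ1] := imply_to_and _ _ N1.
have [g2 {}N2] := not_all_ex_not _ _ N2; have [U2 NZ2] := imply_to_and _ _ N2.
have NC1 : ~ C1 g1 by move=> ?; apply/NZ1/def1.
have NC2 : ~ C2 g2 by move=> ?; apply/NZ2/def2.
have [P1 nzP1 avoid1] := zclosed_avoid zC1 NC1.
have [P2 nzP2 avoid2] := zclosed_avoid zC2 NC2.
have fib x : U x -> grad_fiber d f x by case: oU => C [_ defU] /defU[].
have /(grad_fiberP _ cf nzf hf)[M1 [_ hg1 rel1]] := fib _ U1.
have /(grad_fiberP _ cf nzf hf)[M2 [_ hg2 rel2]] := fib _ U2.
have relh := grad_relD rel2 (grad_relZ (-1) rel1); rewrite !scaleN1r in relh.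
have hh : g2 - g1 \is d.+1.-homog by rewrite rpredB.
have [r nzr Ur] := grad_fiber_open_line hf nzf cf oU U1 hh relh.
have [r1 E1] := coords_line_path P1 g1 (g2 - g1).
have [r2 E2] := coords_line_path P2 g1 (g2 - g1).
(* The first two factors are nonzero at [t = 0], the last at [t = 1], where the line reaches
   [g2]. *)
have nz : r * r1 * r2 != 0.
  rewrite !mulf_neq0 //; first by apply: contraNneq nzr => ->; rewrite horner0.
    apply: contraNneq nzP1 => r0.
    by rewrite -[g1]addr0 -(scale0r (g2 - g1)) -E1 r0 horner0.
  apply: contraNneq nzP2 => r0.
  by rewrite -(subrKC g1 g2) -[g2 - g1]scale1r -E2 r0 horner0.
have /closed_nonrootP[t] := nz; rewrite rootE !hornerM !mulf_eq0 !negb_or E1 E2.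
case/andP=> /andP[/Ur Ut /avoid1 NC1t] /avoid2 NC2t.
by have /cover[/def1[]|/def2[]] := Ut.
Qed.

(** The chain consists of the point of [f] inside the irreducible [U]; it is strict because a line
    towards the companion leaves the multiples of [f]. *)
Lemma companion_pos_fiber_dim f : f \is d.+1.-homog -> f != 0 -> concise f ->
  has_companion d f -> pos_fiber_dim d f.
Proof.
move=> hf nzf cf [M [g [hg rel Nfg]]] U oU Uf.
have fib x : U x -> grad_fiber d f x by case: oU => C [_ defU] /defU[].
exists (fun x => U x /\ exists c, x = c *: f), U; split=> [||x []//|].
- split.
    exists (coords_proportional d f); split; first exact: zclosed_coords_proportional.
    move=> x; split=> -[Ux px]; split=> //; have [[hx _ _] _] := fib _ Ux.
      exact/coords_proportionalP.
    exact/(coords_proportionalP hf hx nzf).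
  have Zf : U f /\ exists c, f = c *: f by split=> //; exists 1; rewrite scale1r.
  split=> [|Z1 Z2 [C1 [zC1 def1]] [C2 [zC2 def2]] cover]; first by exists f.
  have [/def1[_ Cf]|/def2[_ Cf]] := (cover f).1 Zf; [left|right] => x Zx.
    by apply/def1; split=> //; have [_ [c ->]] := Zx; apply: zclosed_scale zC1 Cf.
  by apply/def2; split=> //; have [_ [c ->]] := Zx; apply: zclosed_scale zC2 Cf.
- split; last exact: open_in_grad_fiber_irreducible cf oU Uf.
  by exists (fun _ => True); split; [apply: zclosedT|tauto].
have [r nzr Ur] := grad_fiber_open_line hf nzf cf oU Uf hg rel.
have nzrX : r * 'X != 0.
  by rewrite mulf_neq0 ?polyX_eq0 //; apply: contraNneq nzr => ->; rewrite horner0.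
have /closed_nonrootP[t] := nzrX; rewrite rootE hornerM hornerX mulf_eq0 negb_or.
case/andP=> /Ur Ut nzt; exists (f + t *: g); split=> // -[_ [c Ec]].
case/eqP: (Nfg (t^-1 * (c - 1))).
by rewrite -scalerA scalerBl scale1r -Ec addrAC subrr add0r scalerA mulVf // scale1r.
Qed.

(** Take a strict chain in the whole fiber. If the fiber were a single projective point, both
    members would coincide, since closed sets are cones. *)
Lemma pos_fiber_dim_companion f : f \is d.+1.-homog -> f != 0 -> concise f ->
  pos_fiber_dim d f -> has_companion d f.
Proof.
move=> hf nzf cf pos.
have oF : open_in d (grad_fiber d f) (grad_fiber d f).
  by exists (fun _ => False); split; [apply: zclosed0|tauto].
have fib_f : grad_fiber d f f by split; [split|].
have [Z0 [Z1 [[[C [zC def0]] [[g0 Zg0] _]] [[C1 [_ def1]] _] _ [g1 [Zg1 NZg1]]]]]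
  := pos _ oF fib_f.
have companion g : grad_fiber d f g -> has_companion d f \/ exists c, g = c *: f.
  move=> fg; have /(grad_fiberP _ cf nzf hf)[M [_ hg rel]] := fg.
  have [Efg|Nfg] := classic (exists c, g = c *: f); [by right|left].
  by exists M, g; split=> // c; apply/eqP => Ec; apply: Nfg; exists c.
have [fib0 Cg0] := (def0 g0).1 Zg0; have [fib1 _] := (def1 g1).1 Zg1.
have [//|[c0 E0]] := companion _ fib0; have [//|[c1 E1]] := companion _ fib1.
case: NZg1; apply/def0; split=> //.
have -> : g1 = (c1 / c0) *: g0.
  rewrite E1 E0 scalerA divfK //; case: fib0 => -[_ + _] _.
  by rewrite E0; apply: contraNneq => ->; rewrite scale0r.
by apply: zclosed_scale zC Cg0.
Qed.

End Fiber.

(** * Semistability *)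

(** The exponent of [t] by which [diag(t^w_i)] scales the monomial [m]. *)
Definition mnm_weight n (w : 'I_n -> int) (m : 'X_{1..n}) : int :=
  \sum_i w i * (m i)%:Z.

Lemma mnm_weightD n (w : 'I_n -> int) m1 m2 :
  mnm_weight w (m1 + m2)%MM = mnm_weight w m1 + mnm_weight w m2.
Proof.
rewrite /mnm_weight -big_split /=; apply: eq_bigr => i _.
by rewrite mnmDE PoszD mulrDr.
Qed.

Lemma mnm_weightU n (w : 'I_n -> int) i : mnm_weight w U_(i)%MM = w i.
Proof.
rewrite /mnm_weight (bigD1 i) //= mnm1E eqxx mulr1 big1 ?addr0 // => j ne_ji.
by rewrite mnm1E eq_sym (negPf ne_ji) mulr0.
Qed.

Lemma mnm_weight_const n (w : 'I_n -> int) (c : int) (m : 'X_{1..n}) :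
  (forall i, m i != 0%N -> w i = c) -> mnm_weight w m = c * (mdeg m)%:Z.
Proof.
move=> wc; rewrite mdegE (big_morph _ PoszD (erefl 0%:Z)) mulr_sumr.
apply: eq_bigr => i _; have [->|/wc-> //] := eqVneq (m i) 0%N.
by rewrite !mulr0.
Qed.

Lemma mnm_weight_ge n (w : 'I_n -> int) (c : int) (m : 'X_{1..n}) :
  (forall i, m i != 0%N -> c <= w i) -> c * (mdeg m)%:Z <= mnm_weight w m.
Proof.
move=> wc; rewrite mdegE (big_morph _ PoszD (erefl 0%:Z)) mulr_sumr.
apply: ler_sum => i _; have [->|/wc le_c] := eqVneq (m i) 0%N.
  by rewrite !mulr0.
by rewrite ler_wpM2r.
Qed.

Lemma lin_subst_diag (k : fieldType) n (v : 'rV[k]_n) (f : {mpoly k[n]}) :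
  f \mPo lin_subst (diag_mx v)
  = \sum_(m <- msupp f) (f@_m * \prod_i v 0 i ^+ m i) *: 'X_[m].
Proof.
rewrite comp_mpolyEX; apply: eq_bigr => m _; rewrite -scalerA; congr (_ *: _).
rewrite comp_mpolyX mpolyXE_id -scaler_prod; apply: eq_bigr => i _.
rewrite -exprZn; congr (_ ^+ _); rewrite tnth_lin_subst (bigD1 i) //= mxE eqxx.
by rewrite mulr1n big1 ?addr0 // => j /negPf ne; rewrite mxE eq_sym ne scale0r.
Qed.

(* Hilbert-Mumford, easy direction: a one-parameter subgroup of [SL(n)] that
   drives [f] to [0] kills every nonconstant homogeneous invariant at [f]. *)
Lemma positive_weights_not_semistable (k : closedFieldType) n d
    (f : {mpoly k[n]}) (A : 'M[k]_n) (w : 'I_n -> int) :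
  f \is d.+1.-homog -> A \in unitmx -> \sum_i w i = 0 ->
  (forall m, m \in msupp (f \mPo lin_subst A) -> 0 < mnm_weight w m) ->
  ~ semistable d f.
Proof.
move=> hf uA w0 wpos [P [e [e_gt0 hP inv nzP]]].
set F := f \mPo lin_subst A in wpos.
pose B := invmx A.
(* Coordinates of the translate of [f] by [A D B], polynomial in [t] without constant term because
   the weights are positive. *)
pose q (j : 'I_(ncoord n d)) : {poly k} := \sum_(m <- msupp F)
  (F@_m * coords ('X_[m] \mPo lin_subst B) j) *: 'X^(absz (mnm_weight w m)).
have [r Er] := meval_path P q.
have rt t : t != 0 -> r.[t] = P.@[@coords k n d f].
  move=> nzt; pose D := diag_mx (\row_i t ^ w i).
  have tsum (I : finType) (z : I -> int) : \prod_i t ^ z i = t ^ (\sum_i z i).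
    apply/esym/(big_morph (fun z => t ^ z)); last by rewrite expr0z.
    by move=> x y; rewrite expfzDr.
  (* Conjugating by [A] gives determinant one although [A] is merely invertible. *)
  have detD : \det (A *m D *m B) = 1.
    rewrite !det_mulmx det_inv det_diag mulrAC mulfV ?mul1r -?unitfE -?unitmxE //.
    under eq_bigr => i _ do rewrite mxE.
    by rewrite tsum w0 expr0z.
  rewrite -(inv _ detD _ hf) Er; apply: meval_eq => j.
  rewrite -!lin_substM -/F lin_subst_diag rmorph_sum /coords raddf_sum horner_sum.
  rewrite big_seq [RHS]big_seq; apply: eq_bigr => m mF /=.
  rewrite hornerZ hornerXn comp_mpolyZ mcoeffZ mulrAC; congr (_ * _ * _).
  under eq_bigr => i _ do rewrite mxE exprnP exprz_exp.
  by rewrite tsum exprnP gtz0_abs // wpos.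
have r0 : r.[0] = 0.
  rewrite Er (meval_eq (v2 := fun j => 0 * 1)) => [|j].
    by rewrite (dhomog_meval_scale _ _ hP) expr0n eqn0Ngt e_gt0 mul0r.
  rewrite /q horner_sum mul0r big_seq big1 // => m /wpos wm.
  by rewrite hornerZ hornerXn expr0n absz_eq0 gt_eqF // mulr0.
(* [r] is constant off [t = 0], hence constant, as the field is infinite. *)
have /eqP : (r - (P.@[@coords k n d f])%:P) * 'X = 0.
  apply/eqP; apply: contraT => /closed_nonrootP[t].
  rewrite rootE hornerM hornerX !hornerE mulf_eq0 negb_or => /andP[nz nzt].
  by rewrite rt // subrr eqxx in nz.
rewrite mulf_eq0 polyX_eq0 orbF subr_eq0 => /eqP Er0.
by rewrite Er0 hornerC in r0; rewrite r0 eqxx in nzP.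
Qed.


(** A relation among the partials lets one variable be eliminated; a very negative weight on that
    variable and weight 1 on the others then destabilizes [f]. *)
Lemma semistable_concise (k : closedFieldType) n d (f : {mpoly k[n]}) :
  (forall p : nat, p \in [pchar k] -> ~~ (p %| d.+1`!)%N) ->
  f \is d.+1.-homog -> semistable d f -> concise f.
Proof.
case: n f => [|n] f charP hf ssf; first by move=> c _ [].
apply: mulmx_inj_concise => v v0; apply/eqP; apply: contraT => nzv.
pose A := col_ebase v^T; pose U := row_ebase v^T.
have uA : A \in unitmx by apply: col_ebase_unit.
have uU : U \in unitmx by apply: row_ebase_unit.
have rv : \rank v^T = 1%N by rewrite mxrank_tr rank_rV nzv.
(* The first column of [A] is a multiple of the relation [v], so the new 0-th partial vanishes. *)
have Apid : A *m pid_mx 1 = v^T *m invmx U.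
  by rewrite -[in RHS](mulmx_ebase v^T) rv mulmxK.
set F := f \mPo lin_subst A.
have hF : F \is d.+1.-homog by apply: dhomog_lin_subst.
have dF : mderiv 0 F = 0.
  have /(congr1 (fun B : 'cV_1 => B 0 0)) :
      (pid_mx 1 : 'M[k]_(n.+1, 1))^T^:MP *m gradv F = 0.
    rewrite gradv_lin_subst mulmxA -map_mxM -trmx_mul Apid trmx_mul trmxK map_mxM.
    rewrite -mulmxA -(map_mpolyC_comp v (lin_subst A)).
    by rewrite -(map_mxM (comp_mpoly (lin_subst A))) v0 map_mx0 mulmx0.
  rewrite mul_gradvE (bigD1 0) //= !mxE scale1r big1 ?addr0 // => i nz_i.
  by rewrite !mxE /= -val_eqE /= in nz_i *; rewrite (negPf nz_i) scale0r.
pose w (i : 'I_n.+1) : int := if i == 0 then - n%:Z else 1.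
exfalso; apply: (positive_weights_not_semistable (w := w) hf uA _ _ ssf).
  rewrite big_ord_recl /w eqxx (eq_bigr (fun=> 1)) //.
  by rewrite sumr_const card_ord -natz addNr.
move=> m mF; have m0 := mderiv_eq0_exponent charP hF dF mF.
rewrite (mnm_weight_const (c := 1)) ?mul1r ?(dhomog_mf hF mF) // => i.
by rewrite /w; have [->|//] := eqVneq i 0; rewrite m0.
Qed.

Lemma sum_lds_weight n l p (a b c : int) : n = (l + (l + p))%N ->
  \sum_(i < n) (if (i < l)%N then a else if (i < l + l)%N then b else c)
  = a * l%:Z + (b * l%:Z + c * p%:Z).
Proof.
move=> def_n; subst n; rewrite big_split_ord big_split_ord /=.
rewrite (eq_bigr (fun=> a)) => [|i _]; last by rewrite ltn_ord.
rewrite [X in _ + (X + _)](eq_bigr (fun=> b)) => [|i _]; last first.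
  by rewrite ltnNge leq_addr /= ltn_add2l ltn_ord.
rewrite [X in _ + (_ + X)](eq_bigr (fun=> c)) => [|i _]; last first.
  by rewrite ltnNge leq_addr /= ltn_add2l ltnNge leq_addr.
by rewrite !sumr_const !card_ord -(mulr_natr a) -(mulr_natr b) -(mulr_natr c) !natz.
Qed.

Lemma LDS_not_semistable (k : closedFieldType) n d (f : {mpoly k[n]}) :
  f \is d.+1.-homog -> (1 < d)%N -> LDS d f -> ~ semistable d f.
Proof.
move=> hf d_gt1 [A [l [H [G [uA /andP[l_gt0 le_l] [hH vH] [hG vG] defF]]]]].
have [p def_n] : exists p, n = (l + (l + p))%N by exists (n - (l + l))%N; lia.
have [d' def_d] : exists d', d = d'.+2 by exists d.-2; lia.
(* The weights [a] and [b], [l] times each, and [l], [p] times, sum to zero. They are positive on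
   the variables of [G], and terms of [lds_part] have weight [a + d b >= 2 l] once [d >= 2]. *)
pose a : int := - (l + p).*2%:Z; pose b : int := (l.*2 + p)%:Z.
pose w (i : 'I_n) : int :=
  if (i < l)%N then a else if (i < l + l)%N then b else l%:Z.
apply: (positive_weights_not_semistable (w := w) hf uA).
  rewrite (sum_lds_weight _ _ _ def_n) /a /b.
  by rewrite -!muln2 !PoszM !PoszD !PoszM; ring.
move=> m; rewrite defF => /msuppD_le; rewrite mem_cat => /orP[|mG]; last first.
  apply: lt_le_trans (mnm_weight_ge (c := 1) _); first by rewrite mul1r (dhomog_mf hG mG).
  move=> i /(vG _ mG) /andP[le_li _].
  by rewrite /w ltnNge le_li /=; case: ifP; rewrite /b; lia.
pose pos (g : {mpoly k[n]}) := forall x, x \in msupp g -> 0 < mnm_weight w x.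
have posD g h : pos g -> pos h -> pos (g + h).
  by move=> Hp Hq x /msuppD_le; rewrite mem_cat => /orP[/Hp|/Hq].
have pos0 : pos 0 by move=> x; rewrite msupp0.
move: m; apply: (big_ind pos) => // i _; apply: (big_ind pos) => // j.
case/andP=> lt_il _ x /msuppM_le/allpairsP[[m1 m2] /= [+ m2H ->]].
rewrite msuppX inE => /eqP->.
rewrite mnm_weightD mnm_weightU (mnm_weight_const (c := b)) => [|x' nzx'].
  rewrite /w lt_il (dhomog_mf (dhomog_mderiv j hH) m2H) def_d /a /b -PoszM.
  by rewrite -addn2 mulnDr; move: (_ * d')%N => z; lia.
have : (m2 + U_(j))%MM \in msupp H.
  move: m2H; rewrite !mcoeff_msupp mcoeff_deriv; apply: contraNneq => ->.
  by rewrite mul0rn.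
move/vH/(_ x'); rewrite mnmDE addn_eq0 negb_and nzx' => /(_ isT)/andP[le_l' lt_l'].
by rewrite /w ltnNge le_l' lt_l'.
Qed.

(** * Forms of degree at most two *)

Lemma symmetric_anisotropic_vector (k : fieldType) n (Q : 'M[k]_n) :
  2%:R != 0 :> k -> Q^T = Q -> Q != 0 ->
  exists v : 'cV[k]_n, (v^T *m Q *m v) 0 0 != 0.
Proof.
move=> nz2 symQ nzQ.
have [i [j nzij]] : exists i j, Q i j != 0.
  have /matrix0Pn[i [j]] := nzQ; by exists i, j.
pose e x : 'cV[k]_n := delta_mx x 0.
have b x y : ((e x)^T *m Q *m e y) 0 0 = Q x y.
  by rewrite trmx_delta -rowE -colE !mxE.
have [nzi|/negPn/eqP i0] := boolP (Q i i != 0); first by exists (e i); rewrite b.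
have [nzj|/negPn/eqP j0] := boolP (Q j j != 0); first by exists (e j); rewrite b.
(* With both diagonal entries zero, the quadratic form takes the value [2 Q_ij] here. *)
exists (e i + e j).
have addE (A B : 'M[k]_1) : (A + B) 0 0 = A 0 0 + B 0 0 by rewrite mxE.
have -> : (e i + e j)^T = (e i)^T + (e j)^T by rewrite linearD.
rewrite !mulmxDl !mulmxDr !addE !b i0 j0.
rewrite add0r addr0; have -> : Q j i = Q i j by rewrite -[in LHS]symQ mxE.
by rewrite -mulr2n -mulr_natr mulf_neq0.
Qed.

Lemma dhomog0_const (k : fieldType) n (p : {mpoly k[n]}) :
  p \is 0.-homog -> p = (p@_0)%:MP.
Proof.
move=> hp; apply/mpolyP => m; rewrite mcoeffC.
have [->|nzm] := eqVneq m 0%MM; first by rewrite mulr1.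
by rewrite mulr0 (dhomog_nemf_coeff hp) //= mdeg_eq0.
Qed.

(* In degree at most two the Hessian is a constant symmetric matrix [Q], and
   the projection [Q v v^T / (v^T Q v)] splits off one variable. *)
Lemma low_degree_direct_sum (k : fieldType) n d (f : {mpoly k[n]}) :
  (forall p : nat, p \in [pchar k] -> ~~ (p %| d.+1`!)%N) ->
  f \is d.+1.-homog -> concise f -> (d <= 1)%N -> (1 < n)%N -> direct_sum d f.
Proof.
move=> charP hf cf d_le1 n_gt1.
pose Q : 'M[k]_n := map_mx (mcoeff 0%MM) (hess f).
have hessQ : hess f = Q^:MP.
  apply/matrixP => i j; rewrite !mxE; case: d d_le1 hf {charP} => [|[|//]] _ hf.
    rewrite (dhomog0_const (dhomog_mderiv j hf)) mderivC mcoeff0.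
    by rewrite mpolyC0.
  exact/dhomog0_const/dhomog_mderiv/dhomog_mderiv.
have symQ : Q^T = Q by rewrite map_trmx hess_tr.
have hsym (E : 'M[k]_n) : E *m Q = Q *m E^T -> hess_sym f E.
  by move=> EQ; rewrite /hess_sym hessQ -!map_mxM EQ.
(* If [Q = 0], every matrix satisfies the symmetry, in particular a coordinate projection. *)
have [Q0|nzQ] := eqVneq Q 0.
  have n_gt0 : (0 < n)%N by apply: ltnW.
  pose i0 := Ordinal n_gt0; pose i1 := Ordinal n_gt1.
  apply: (idempotent_direct_sum charP (E := delta_mx i0 i0) hf cf).
  - by apply: hsym; rewrite Q0 mulmx0 mul0mx.
  - by rewrite mul_delta_mx.
  - by apply/eqP => /matrixP/(_ i0 i0)/eqP; rewrite !mxE eqxx oner_eq0.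
  - by apply/eqP => /matrixP/(_ i1 i1)/eqP; rewrite !mxE eqxx eq_sym oner_eq0.
(* A nonzero Hessian forces [d = 1], so that 2 is the degree. *)
have nz2 : 2%:R != 0 :> k.
  apply: (natr_neq0_small charP); case: d d_le1 hf {charP} => [|[|//]] _ hf //.
  case/eqP: nzQ; apply/matrixP => i j; rewrite !mxE.
  by rewrite (dhomog0_const (dhomog_mderiv j hf)) mderivC mcoeff0.
have [v] := symmetric_anisotropic_vector nz2 symQ nzQ.
set s := _ 0 0 => nzs; have Es : v^T *m Q *m v = s%:M by apply: mx11_scalar.
pose E := s^-1 *: (Q *m v *m v^T).
have vE : v^T *m E = v^T.
  by rewrite -scalemxAr !mulmxA Es mul_scalar_mx scalerA mulVf // scale1r.
apply: (idempotent_direct_sum charP (E := E) hf cf).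
- apply: hsym; rewrite /E linearZ /= -scalemxAl -scalemxAr !trmx_mul trmxK symQ.
  by rewrite !mulmxA.
- by rewrite {1}/E -scalemxAl -mulmxA vE.
- apply: contraNneq nzs => E0; rewrite /s -vE E0 mulmx0 !mul0mx mxE; exact: eqxx.
- apply/eqP => E1; have := mxrank1 k n; rewrite -E1 => rE.
  have : (\rank E <= 1)%N.
    rewrite (leq_trans (mxrank_scale _ _)) // (leq_trans (mxrankM_maxr _ _)) //.
    exact: rank_leq_row.
  by rewrite rE leqNgt n_gt1.
Qed.

Theorem theorem3p2 (k : closedFieldType) (n d : nat) :
  (forall p : nat, p \in [pchar k] -> ~~ (p %| d.+1`!)%N) ->
  (forall f : {mpoly k[n]}, f \is (d.+1).-homog -> f != 0 -> concise f ->
     [<-> direct_sum d f \/ LDS d f;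
          grad_not_injective d f;
          pos_fiber_dim d f])
  /\
  (forall f : {mpoly k[n]}, f \is (d.+1).-homog -> f != 0 -> semistable d f ->
     [<-> direct_sum d f;
          grad_not_injective d f;
          pos_fiber_dim d f]).
Proof.
move=> charP; split=> f hf nzf.
  move=> cf; tfae.
  - move=> shape; apply: companion_grad_not_injective => //.
    by case: shape => [/direct_sum_companion|/LDS_companion]; apply.
  - by move/grad_not_injective_companion/companion_pos_fiber_dim; apply.
  - move/pos_fiber_dim_companion => pos.
    by apply: companion_direct_sum_or_LDS => //; apply: pos.
move=> ssf; have cf := semistable_concise charP hf ssf; tfae.
- by move/direct_sum_companion; apply: companion_grad_not_injective.
- by move/grad_not_injective_companion/companion_pos_fiber_dim; apply.
- move/pos_fiber_dim_companion => /(_ hf nzf cf) comp.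
  have [//|lds] := companion_direct_sum_or_LDS charP hf cf comp.
  (* An LDS form of degree at most two may be semistable; [1 <= l <= n - l] gives the two variables
     needed to split it. *)
  have [d_le1|d_gt1] := leqP d 1.
    case: lds => A [l [H [G [_ le_l _ _ _]]]].
    by apply: low_degree_direct_sum => //; lia.
  by case: (LDS_not_semistable hf d_gt1 lds).
Qed.
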